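(* Let $m\in\mathbb{N}$, $q=3^{2m+1}$ and $U={}^2G_2^{syl}(q)$. For each $t\in\mathbb{F}_q^*$ fix a transversal ${}^{t}T$ of $\mathrm{im}\,\varsigma_t$ in $\mathbb{F}_q^+$, where $\varsigma_t(s)=ts^{3\theta}-t^{3\theta}s$. Then the conjugacy classes of $U$ are the following, listed with a representative and cardinality: \begin{itemize} \item representative $I_8$: class $\{Y(0,0,0)\}$, of size $1$; \item representative $Y(0,0,t_4^* )$ with $t_4^*\in\mathbb{F}_q^*$: class $\{Y(0,0,t_4^* )\}$, of size $1$; \item representative $Y(0,t_3^*,0)$ with $t_3^*\in\mathbb{F}_q^*$: class $\{Y(0,t_3^*,s_4): s_4\in\mathbb{F}_q\}$, of size $q$; \item representative $Y(t_1^*,t_3,0)$ with $t_1^*\in\mathbb{F}_q^*$ and $t_3\in{}^{t_1^*}T$: class $\{Y(t_1^*,\tilde s_3,s_4): \tilde s_3\in t_3+\mathrm{im}\,\varsigma_{t_1^*},\ s_4\in\mathbb{F}_q\}$, of size $q\cdot3^{2m}$. \end{itemize}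
   Context: Let $m\in\mathbb{N}=\{0,1,2,\dots\}$, $q=3^{2m+1}$, $\theta=3^m$; $\mathbb{F}_q^*=\mathbb{F}_q\setminus\{0\}$, and $e_{i,j}$ are the $8\times8$ matrix units over $\mathbb{F}_q$. Put $E_1=(e_{1,2}-e_{7,8})+(e_{3,4}-e_{5,6})+(e_{3,5}-e_{4,6})$, $E_2=e_{2,3}-e_{6,7}$, $E_3=-(e_{1,3}-e_{6,8})+(e_{2,4}-e_{5,7})+(e_{2,5}-e_{4,7})$, $E_4=-(e_{1,4}-e_{5,8})-(e_{2,6}-e_{3,7})-(e_{1,5}-e_{4,8})$, $E_5=-(e_{1,6}-e_{3,8})$, $E_6=-(e_{1,7}-e_{2,8})$, and $y_i(t)=I_8+tE_i+\tfrac12t^2E_i^2$ for $t\in\mathbb{F}_q$. For $t_1,t_3,t_4\in\mathbb{F}_q$ set $$Y(t_1,t_3,t_4)=y_2(t_1^{3\theta})\,y_1(t_1)\,y_3(t_3)\,y_4(t_4)\,y_5(t_3^{3\theta}+t_1^{3\theta+3})\,y_6(t_4^{3\theta}+t_1^{6\theta+3}).$$ Then $U={}^2G_2^{syl}(q)=\{Y(t_1,t_3,t_4): t_1,t_3,t_4\in\mathbb{F}_q\}$, a group of order $q^3$ (a Sylow $3$-subgroup of the Ree group ${}^2G_2(q)$). For $t\in\mathbb{F}_q^*$ the map $\varsigma_t:\mathbb{F}_q^+\to\mathbb{F}_q^+$, $s\mapsto ts^{3\theta}-t^{3\theta}s$, is an endomorphism of the additive group $\mathbb{F}_q^+$. A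 transversal of a subgroup is a complete set of coset representatives. *)

(* Defs.v *)
From mathcomp Require Import all_boot all_order all_algebra all_fingroup.

Set Implicit Arguments.
Unset Strict Implicit.
Unset Printing Implicit Defensive.

Import GRing.Theory.
Local Open Scope ring_scope.

(* The matrix unit e_{i,j}, with rows and columns numbered from 1 to 8. *)
Definition emx (F : finFieldType) (i j : nat) : 'M[F]_8 :=
  delta_mx (inord i.-1) (inord j.-1).
Arguments emx {F} i j.

Definition E1 (F : finFieldType) : 'M[F]_8 :=
  (emx 1 2 - emx 7 8) + (emx 3 4 - emx 5 6) + (emx 3 5 - emx 4 6).
Definition E2 (F : finFieldType) : 'M[F]_8 := emx 2 3 - emx 6 7.
Definition E3 (F : finFieldType) : 'M[F]_8 :=
  - (emx 1 3 - emx 6 8) + (emx 2 4 - emx 5 7) + (emx 2 5 - emx 4 7).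
Definition E4 (F : finFieldType) : 'M[F]_8 :=
  - (emx 1 4 - emx 5 8) - (emx 2 6 - emx 3 7) - (emx 1 5 - emx 4 8).
Definition E5 (F : finFieldType) : 'M[F]_8 := - (emx 1 6 - emx 3 8).
Definition E6 (F : finFieldType) : 'M[F]_8 := - (emx 1 7 - emx 2 8).

Definition root_elt (F : finFieldType) (E : 'M[F]_8) (t : F) : 'M[F]_8 :=
  1%:M + t *: E + (2%:R^-1 * t ^+ 2) *: (E *m E).

Definition theta (m : nat) : nat := (3 ^ m)%N.

Definition Ymx (m : nat) (F : finFieldType) (t1 t3 t4 : F) : 'M[F]_8 :=
  let th := theta m in
  root_elt (E2 F) (t1 ^+ (3 * th)) *m root_elt (E1 F) t1 *m
  root_elt (E3 F) t3 *m root_elt (E4 F) t4 *m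
  root_elt (E5 F) (t3 ^+ (3 * th) + t1 ^+ (3 * th + 3)) *m
  root_elt (E6 F) (t4 ^+ (3 * th) + t1 ^+ (6 * th + 3)).

Definition strict_upper (F : finFieldType) (A : 'M[F]_8) : Prop :=
  forall i j : 'I_8, (j <= i)%N -> A i j = 0.

Lemma strict_upper_emx (F : finFieldType) (i j : nat) :
  (0 < i < j)%N -> (j <= 8)%N -> strict_upper (emx i j : 'M[F]_8).
Proof.
case: i j => // i [//|j] /andP[_ ij] j8 k l lk; rewrite mxE.
case: eqP => //= ek; case: eqP => //= el.
have i8 : (i < 8)%N := ltn_trans (ij : (i < j)%N) j8.
by move: lk; rewrite ek el !inordK // leqNgt -ltnS ij.
Qed.

Lemma strict_upperD (F : finFieldType) (A B : 'M[F]_8) :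
  strict_upper A -> strict_upper B -> strict_upper (A + B).
Proof. by move=> hA hB i j ij; rewrite mxE hA ?hB ?addr0. Qed.

Lemma strict_upperN (F : finFieldType) (A : 'M[F]_8) :
  strict_upper A -> strict_upper (- A).
Proof. by move=> hA i j ij; rewrite mxE hA ?oppr0. Qed.

Lemma strict_upperM (F : finFieldType) (A B : 'M[F]_8) :
  strict_upper A -> strict_upper B -> strict_upper (A *m B).
Proof.
move=> hA hB i j ij; rewrite mxE big1 // => k _.
have [ki | ik] := leqP k i; first by rewrite hA ?mul0r.
by rewrite [B k j]hB ?mulr0 // (leq_trans ij (ltnW ik)).
Qed.

Lemma root_elt_unit (F : finFieldType) (E : 'M[F]_8) (t : F) :
  strict_upper E -> root_elt E t \in unitmx.
Proof.
move=> hE; have hE2 := strict_upperM hE hE.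
have entry (i j : 'I_8) : (j <= i)%N -> root_elt E t i j = (i == j)%:R.
  move=> ij; rewrite /root_elt; move: (E *m E) hE2 => EE hEE.
  by rewrite !mxE hE // hEE // !mulr0 !addr0.
move: (root_elt E t) entry => A entry.
rewrite unitmxE -det_tr det_trig.
  by rewrite big1 ?unitr1 // => i _; rewrite mxE entry ?eqxx.
apply/is_trig_mxP => i j ij; rewrite mxE entry ?(ltnW ij) //.
by rewrite -val_eqE /= (gtn_eqF ij).
Qed.

Lemma Ymx_unit (m : nat) (F : finFieldType) (t1 t3 t4 : F) :
  Ymx m t1 t3 t4 \in unitmx.
Proof.
rewrite /Ymx !unitmx_mul !root_elt_unit //;
by do ?[apply: strict_upperD | apply: strict_upperN | exact: strict_upper_emx].
Qed.

Definition Y (m : nat) (F : finFieldType) (t1 t3 t4 : F) : {'GL_8[F]} :=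
  FinRing.unit _ (Ymx_unit m t1 t3 t4).

(* Only a set here; it is a subgroup when #|F| = 3 ^ (2 * m + 1). *)
Definition Usyl (m : nat) (F : finFieldType) : {set {'GL_8[F]}} :=
  [set Y m t.1.1 t.1.2 t.2 | t : F * F * F].
Arguments Usyl : clear implicits.

Definition varsigma (m : nat) (F : finFieldType) (t s : F) : F :=
  t * s ^+ (3 * theta m) - t ^+ (3 * theta m) * s.

Definition im_varsigma (m : nat) (F : finFieldType) (t : F) : {set F} :=
  [set varsigma m t s | s : F].

Definition add_coset (F : finFieldType) (x : F) (H : {set F}) : {set F} :=
  [set x + h | h in H].

Definition add_transversal (F : finFieldType) (T H : {set F}) : bool :=
  is_transversal T [set add_coset x H | x : F] [set: F].

(* An index for the classes: distinct indices stand for distinct lines of the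
   list, so that uniqueness of the index expresses its irredundancy. *)
Inductive class_row (F : Type) : Type :=
  | RowI
  | RowY4 (t4 : F)
  | RowY3 (t3 : F)
  | RowY1 (t1 t3 : F).
Arguments RowI {F}.

Definition row_admissible (F : finFieldType) (T : F -> {set F})
    (r : class_row F) : bool :=
  match r with
  | RowI => true
  | RowY4 t4 => t4 != 0
  | RowY3 t3 => t3 != 0
  | RowY1 t1 t3 => (t1 != 0) && (t3 \in T t1)
  end.

Definition row_representative (m : nat) (F : finFieldType) (r : class_row F) :
    {'GL_8[F]} :=
  match r with
  | RowI => 1%g
  | RowY4 t4 => Y m 0 0 t4
  | RowY3 t3 => Y m 0 t3 0
  | RowY1 t1 t3 => Y m t1 t3 0
  end.

Definition row_class (m : nat) (F : finFieldType) (r : class_row F) :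
    {set {'GL_8[F]}} :=
  match r with
  | RowI => [set Y m 0 0 0]
  | RowY4 t4 => [set Y m 0 0 t4]
  | RowY3 t3 => [set Y m 0 t3 s4 | s4 : F]
  | RowY1 t1 t3 =>
      [set Y m t1 s3 s4 | s3 in add_coset t3 (im_varsigma m t1), s4 in [set: F]]
  end.

Definition row_size (m : nat) (F : finFieldType) (r : class_row F) : nat :=
  match r with
  | RowI => 1%N
  | RowY4 _ => 1%N
  | RowY3 _ => #|F|
  | RowY1 _ _ => (#|F| * 3 ^ (2 * m))%N
  end.

(* Main.v *)
(* Let sigma be the twist x |-> x ^ (3 theta): it is additive, multiplicative, and
   sigma (sigma x) = x ^ 3 because x ^ q = x. Multiplying the 8 x 8 matrices in
   characteristic 3 gives the group law
     Y(a,b,c) Y(x,y,z) =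
       Y(a + x, b + y - a sigma(x), c + z - a^2 sigma(x) + a x sigma(x) - b x),
   so conjugating Y(a,b,c) by Y(x,y,z) fixes a, subtracts varsigma_a(x) from b,
   and changes c by a quantity containing a y (and equal to - b x when a = 0).
   When a <> 0 the free y makes the last coordinate arbitrary; when a = 0 and
   b <> 0 the free x does; when a = b = 0 the element is central. For t <> 0 the
   kernel of varsigma_t is {0, t, -t}, since sigma(u) = u forces u = u^3; hence
   the image has q / 3 = 3 ^ (2 m) elements. *)
Require Import Defs.
From mathcomp Require Import all_boot all_order all_algebra all_fingroup all_field.
From mathcomp Require Import ring.

Set Implicit Arguments.
Unset Strict Implicit.
Unset Printing Implicit Defensive.

Import GRing.Theory.
Local Open Scope ring_scope.

(** * Computing with 8 x 8 matrices given by lists of entries *)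

(* A list of triples (row, column, coefficient), with rows and columns numbered
   from 1 and coefficients at a repeated position adding up. The comparison is
   eqn, not ==, so that cbv computes on these lists without unfolding the ring
   operations. *)
Fixpoint entry (R : nzRingType) (s : seq (nat * nat * R)) (i j : nat) : R :=
  if s is (k, l, x) :: s' then
    if eqn k i && eqn l j then x + entry s' i j else entry s' i j
  else 0.

Definition sparse_mx (R : nzRingType) (s : seq (nat * nat * R)) : 'M[R]_8 :=
  \matrix_(i, j) entry s i.+1 j.+1.

(** All matrices here are upper triangular, so row [i] is listed from its diagonal entry on. *)
Fixpoint upper_entries (R : nzRingType) (i : nat) (rows : seq (seq R)) :
    seq (nat * nat * R) :=
  if rows is r :: rows' then
    [seq (i, c.1, c.2) | c <- zip (iota i (size r)) r] ++
    upper_entries i.+1 rows'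
  else [::].

Definition sparse_scale (R : nzRingType) (x : R) (s : seq (nat * nat * R)) :=
  [seq (c.1, x * c.2) | c <- s].

(** Guards the summation index of a product: triples outside the 8 x 8 range are invisible to
    [sparse_mx] and must not contribute. A [match] lets [cbv] decide it on numerals. *)
Definition index8 (j : nat) : bool :=
  match j with 1 | 2 | 3 | 4 | 5 | 6 | 7 | 8 => true | _ => false end.

Fixpoint sparse_mul_row (R : nzRingType) (i j : nat) (x : R)
    (s : seq (nat * nat * R)) : seq (nat * nat * R) :=
  if s is (k, l, y) :: s' then
    if eqn j k && index8 j then (i, l, x * y) :: sparse_mul_row i j x s'
    else sparse_mul_row i j x s'
  else [::].

Fixpoint sparse_mul (R : nzRingType) (s t : seq (nat * nat * R)) :
    seq (nat * nat * R) :=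
  if s is (i, j, x) :: s' then sparse_mul_row i j x t ++ sparse_mul s' t
  else [::].

Section Sparse.
Variable R : nzRingType.
Implicit Types s t : seq (nat * nat * R).

Lemma index8E j : index8 j = (0 < j <= 8)%N.
Proof. by do 9?[case: j => [|j] //]. Qed.

Lemma entry_cat s t i j : entry (s ++ t) i j = entry s i j + entry t i j.
Proof.
elim: s => [|[[k l] x] s IHs] /=; first by rewrite add0r.
by case: ifP => _; rewrite IHs ?addrA.
Qed.

Lemma entry_scale x s i j : entry (sparse_scale x s) i j = x * entry s i j.
Proof.
elim: s => [|[[k l] y] s IHs] /=; first by rewrite mulr0.
by case: ifP => _; rewrite IHs ?mulrDr.
Qed.

Lemma entry_mul_row k l x t i j :
  entry (sparse_mul_row k l x t) i j =
    if (k == i) && index8 l then x * entry t l j else 0.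
Proof.
elim: t => [|[[k' l'] y] t IHt] /=; first by rewrite mulr0 if_same.
rewrite !eqnE (eq_sym k' l); case: (l == k') => /=; last exact: IHt.
case: ifP => l8 /=; rewrite IHt l8 ?andbF //= !eqnE !andbT.
by case: (k == i); case: (l' == j); rewrite //= mulrDr.
Qed.

Lemma entry_mul s t i j :
  entry (sparse_mul s t) i j = \sum_(k < 8) entry s i k.+1 * entry t k.+1 j.
Proof.
elim: s => [|[[k l] x] s IHs] /=; first by rewrite big1 // => k _; rewrite mul0r.
rewrite entry_cat entry_mul_row IHs index8E !eqnE.
case: (k == i) => /=; last by rewrite add0r.
(* A triple in column [l] only meets the summand with index [l.-1]; for [l] outside 1..8 there is no
   such summand. *)
case: ifP => [/andP[l0 l8]|l8].
  have l8' : (l.-1 < 8)%N by rewrite prednK.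
  rewrite (bigD1 (Ordinal l8')) //= [in RHS](bigD1 (Ordinal l8')) //=.
  rewrite prednK // eqxx mulrDl !addrA; congr (_ + _).
  apply: eq_bigr => m ml; case: eqP => // lm; case/eqP: ml.
  by apply/val_inj; rewrite /= lm.
rewrite add0r; apply: eq_bigr => m _; case: eqP => // lm.
by move: l8; rewrite lm ltn_ord.
Qed.

Lemma sparse_mxD s t : sparse_mx s + sparse_mx t = sparse_mx (s ++ t).
Proof. by apply/matrixP => i j; rewrite !mxE entry_cat. Qed.

Lemma sparse_mxZ x s : x *: sparse_mx s = sparse_mx (sparse_scale x s).
Proof. by apply/matrixP => i j; rewrite !mxE entry_scale. Qed.

Lemma sparse_mxN s : - sparse_mx s = sparse_mx (sparse_scale (-1) s).
Proof. by rewrite -scaleN1r sparse_mxZ. Qed.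

Lemma sparse_mxM s t : sparse_mx s *m sparse_mx t = sparse_mx (sparse_mul s t).
Proof.
apply/matrixP => i j; rewrite !mxE entry_mul.
by apply: eq_bigr => k _; rewrite !mxE.
Qed.

Lemma sparse_mx1 : 1%:M = sparse_mx [seq (i, i, 1 : R) | i <- iota 1 8].
Proof.
apply/matrixP => -[i i8] [j j8]; rewrite !mxE -val_eqE /=.
by move: i j i8 j8 => [|[|[|[|[|[|[|[|?]]]]]]]] [|[|[|[|[|[|[|[|?]]]]]]]] //= _ _;
  rewrite addr0.
Qed.

(** Bounded naturals replace ordinals so that [forall_lt8] can split the claim into 64 goals with
    literal indices, on which [entry] computes. *)
Lemma eq_sparse_mx s t :
  (forall i, (i < 8)%N -> forall j, (j < 8)%N ->
     entry s i.+1 j.+1 = entry t i.+1 j.+1) ->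
  sparse_mx s = sparse_mx t.
Proof. by move=> st; apply/matrixP => i j; rewrite !mxE st. Qed.

Lemma sparse_mx_entry s t :
  sparse_mx s = sparse_mx t ->
  forall i j, (i < 8)%N -> (j < 8)%N -> entry s i.+1 j.+1 = entry t i.+1 j.+1.
Proof.
by move=> /matrixP st i j i8 j8; move: (st (Ordinal i8) (Ordinal j8)); rewrite !mxE.
Qed.

End Sparse.

Lemma forall_lt8 (P : nat -> Prop) :
  P 0%N -> P 1%N -> P 2%N -> P 3%N -> P 4%N -> P 5%N -> P 6%N -> P 7%N ->
  forall i, (i < 8)%N -> P i.
Proof. by move=> P0 P1 P2 P3 P4 P5 P6 P7 [|[|[|[|[|[|[|[|i]]]]]]]]. Qed.

Lemma emx_sparse (F : finFieldType) i j :
  (0 < i <= 8)%N -> (0 < j <= 8)%N -> emx i j = sparse_mx [:: (i, j, 1 : F)].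
Proof.
case: i j => [|i] [|j] //= i8 j8; apply/matrixP => k l; rewrite !mxE /= !eqnE.
by rewrite -!val_eqE /= !inordK // ![_ == val _]eq_sym; case: ifP; rewrite ?addr0.
Qed.

(* A, B and C stand for the images of a, b and c under t |-> t ^+ (3 * theta). *)
Definition ree_entries (R : nzRingType) (a A b B c C : R) :
    seq (nat * nat * R) :=
  upper_entries 1
  [:: [:: 1; a; -b; a * b - c; a * b - c; -A * a ^+ 3 - B - a * c;
          -A ^+ 2 * a ^+ 3 - C - a * b ^+ 2 - b * c;
          -A * a ^+ 3 * b + A ^+ 2 * a ^+ 4 - B * b + C * a - a * b * c - c ^+ 2];
      [:: 1; A; A * a + b; A * a + b; -A * a ^+ 2 - c; A * a * b + A * c - b ^+ 2;
          A * B - A * a * c - A * a ^+ 2 * b - A ^+ 2 * a ^+ 3 + C - b * c];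
      [:: 1; a; a; -a ^+ 2; a * b + c; A * a ^+ 3 + B - a * c - a ^+ 2 * b];
      [:: 1; 0; -a; -b; -a * b + c];
      [:: 1; -a; -b; -a * b + c];
      [:: 1; -A; A * a + b];
      [:: 1; -a];
      [:: 1]].

(** * Matrix identities in characteristic 3 *)

Section Char3.
Variable F : finFieldType.
Hypothesis F3 : 3%:R = 0 :> F.

Lemma natr_char3 n : n%:R = [:: 0; 1; -1]`_(n %% 3) :> F.
Proof.
have N1 : 2%:R = -1 :> F by apply/eqP; rewrite -addr_eq0 natr1 F3.
rewrite {1}(divn_eq n 3) natrD natrM F3 mulr0 add0r.
by case: (n %% 3)%N (ltn_pmod n (isT : 0 < 3)%N) => [|[|[|]]].
Qed.

Lemma oppr_natr_char3 n : - n%:R = [:: 0; -1; 1]`_(n %% 3) :> F.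
Proof.
rewrite natr_char3.
by case: (n %% 3)%N (ltn_pmod n (isT : 0 < 3)%N) => [|[|[|]]] //= _;
  rewrite ?oppr0 ?opprK.
Qed.

(* The ring tactic only erases coefficients equal to the left-hand side of one of
   the given equations, so each coefficient that occurs has its own equation. *)
Ltac ring3 :=
  ring: (natr_char3 2 : 2%:R = -1 :> F)
    (natr_char3 3 : 3%:R = 0 :> F)
    (natr_char3 4 : 4%:R = 1 :> F)
    (natr_char3 5 : 5%:R = -1 :> F)
    (natr_char3 6 : 6%:R = 0 :> F)
    (natr_char3 9 : 9%:R = 0 :> F)
    (natr_char3 11 : 11%:R = -1 :> F)
    (natr_char3 15 : 15%:R = 0 :> F)
    (oppr_natr_char3 2 : - 2%:R = 1 :> F)
    (oppr_natr_char3 3 : - 3%:R = 0 :> F)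
    (oppr_natr_char3 4 : - 4%:R = -1 :> F)
    (oppr_natr_char3 6 : - 6%:R = 0 :> F).

Ltac compute_sparse :=
  cbv [ree_entries upper_entries zip size sparse_mul sparse_mul_row
       sparse_scale cat map iota eqn index8 andb fst snd].

Ltac split_lt8 :=
  match goal with |- forall i, _ -> @?P i => apply (@forall_lt8 P) end; cbv beta.

Ltac entrywise :=
  apply: eq_sparse_mx; do 2 split_lt8;
  cbv [entry eqn andb]; ring3.

(** Treating [A], [B], [C] as independent of [a], [b], [c] removes the exponent [theta m]: each
    entry becomes a polynomial identity modulo 3. *)
Lemma root_elts_sparse (a A b B c C : F) :
  root_elt (E2 F) A *m root_elt (E1 F) a *m root_elt (E3 F) b *m
  root_elt (E4 F) c *m root_elt (E5 F) (B + A * a ^+ 3) *m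
  root_elt (E6 F) (C + A ^+ 2 * a ^+ 3) = sparse_mx (ree_entries a A b B c C).
Proof.
(* In characteristic 3 the coefficient 1/2 is -1, so no inverse is left. *)
rewrite /root_elt (natr_char3 2) invrN1 /E1 /E2 /E3 /E4 /E5 /E6.
rewrite !emx_sparse // sparse_mx1.
rewrite !(sparse_mxN, sparse_mxD, sparse_mxM, sparse_mxZ).
by compute_sparse; entrywise.
Qed.

(** Again a formal identity. The new values of [A], [B], [C] are what the twist makes of the new
    [a], [b], [c] once it sends [X] to [x ^+ 3]. *)
Lemma ree_entries_mul (a A b B c C x X y Y z Z : F) :
  sparse_mx (ree_entries a A b B c C) *m sparse_mx (ree_entries x X y Y z Z) =
  sparse_mx (ree_entries (a + x) (A + X) (b + y - a * X) (B + Y - A * x ^+ 3)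
    (c + z - a ^+ 2 * X + a * x * X - b * x)
    (C + Z - A ^+ 2 * x ^+ 3 + A * X * x ^+ 3 - B * X)).
Proof.
rewrite sparse_mxM.
by compute_sparse; entrywise.
Qed.

End Char3.

(** * The twist and the group law in coordinates *)

Definition ree_twist (m : nat) (R : nzRingType) (x : R) : R :=
  x ^+ (3 * theta m).

Section Ree.
Variables (m : nat) (F : finFieldType).
Hypothesis cardF : #|F| = (3 ^ (2 * m + 1))%N.

Local Notation sigma := (@ree_twist m F).

Lemma char3 : 3%N \in [pchar F].
Proof. exact: card_finPcharP cardF _. Qed.

Let F3 : 3%:R = 0 :> F := pcharf0 char3.

Lemma ree_twistD x y : sigma (x + y) = sigma x + sigma y.
Proof.
rewrite /ree_twist -expnS exprDn_pchar // pnatX; apply/orP; left.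
by rewrite pnatE // char3.
Qed.

Lemma ree_twistN x : sigma (- x) = - sigma x.
Proof. by rewrite /ree_twist exprNn -signr_odd oddM oddX orbT expr1 mulN1r. Qed.

Lemma ree_twistB x y : sigma (x - y) = sigma x - sigma y.
Proof. by rewrite ree_twistD ree_twistN. Qed.

Lemma ree_twistM x y : sigma (x * y) = sigma x * sigma y.
Proof. exact: exprMn. Qed.

Lemma ree_twist0 : sigma 0 = 0.
Proof. by rewrite /ree_twist expr0n muln_eq0 expn_eq0. Qed.

Lemma ree_twistK x : sigma (sigma x) = x ^+ 3.
Proof.
(* Writing [x ^+ 3] as its own q-th power gives the exponent 3q = 3^(2m+2), the square of
   3^(m+1). *)
rewrite /ree_twist -exprM -[RHS](expf_card (x ^+ 3)) -exprM cardF; congr (_ ^+ _).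
by rewrite mulnACA -expnD -[(3 * 3)%N]/(3 ^ 2)%N -expnD -expnS addnn mul2n addn1.
Qed.

Lemma Ymx_sparse a b c :
  Ymx m a b c = sparse_mx (ree_entries a (sigma a) b (sigma b) c (sigma c)).
Proof.
rewrite -root_elts_sparse // /ree_twist -exprM /Ymx !(exprD _ (_ * _) 3).
by rewrite mulnAC.
Qed.

Lemma YM a b c x y z :
  (Y m a b c * Y m x y z)%g =
  Y m (a + x) (b + y - a * sigma x)
      (c + z - a ^+ 2 * sigma x + a * x * sigma x - b * x).
Proof.
apply/val_inj; change (Ymx m a b c *m Ymx m x y z = Ymx m (a + x)
  (b + y - a * sigma x) (c + z - a ^+ 2 * sigma x + a * x * sigma x - b * x)).
rewrite [Ymx m a b c]Ymx_sparse [Ymx m x y z]Ymx_sparse [RHS]Ymx_sparse.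
rewrite (ree_entries_mul F3).
by rewrite !(ree_twistB, ree_twistD) !ree_twistM !ree_twistK.
Qed.

Lemma Y_inj (a b c x y z : F) :
  Y m a b c = Y m x y z -> [/\ a = x, b = y & c = z].
Proof.
move=> /(congr1 val) eY; have {eY} : Ymx m a b c = Ymx m x y z by [].
rewrite !Ymx_sparse => /sparse_mx_entry eY.
(* Entries (1,2), (1,3), (1,4) are [a], [- b] and [a * b - c], which determine the three coordinates
   in turn. *)
move: (eY 0%N 1%N isT isT) (eY 0%N 2%N isT isT) (eY 0%N 3%N isT isT).
rewrite /= !addr0.
by move=> -> /oppr_inj -> /addrI/oppr_inj ->.
Qed.

Lemma eq_Y (a b c x y z : F) :
  a = x -> b = y -> c = z -> Y m a b c = Y m x y z.
Proof. by move=> -> -> ->. Qed.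

(** By the group law this element equals its own square, hence is the identity. *)
Lemma Y000 : Y m 0 0 0 = 1%g :> {'GL_8[F]}.
Proof.
by apply: (mulgI (Y m 0 0 0)); rewrite YM mulg1 !mul0r expr0n !mul0r !addr0 !subr0.
Qed.

(** * Conjugation, and cosets of the image of [varsigma] *)

Lemma Y_conj (a b c x y z : F) :
  (Y m a b c ^ Y m x y z)%g =
  Y m a (b - varsigma m a x)
    (c - a ^+ 2 * sigma x + a * x * sigma x - b * x + x ^+ 2 * sigma a
     - a * x * sigma a + a * y).
Proof.
(* Multiplying by the conjugating element leaves two plain products to compare, so no formula for
   inverses is needed. *)
apply: (mulgI (Y m x y z)); rewrite -conjgC !YM.
rewrite /varsigma -!/(ree_twist m _).
by apply: eq_Y; ring.
Qed.

Lemma mem_Usyl (a b c : F) : Y m a b c \in Usyl m F.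
Proof. by apply/imsetP; exists (a, b, c). Qed.

Lemma mem_classY (a b c : F) (g : {'GL_8[F]}) :
  reflect (exists x y z, g = (Y m a b c ^ Y m x y z)%g)
          (g \in (Y m a b c ^: Usyl m F)%g).
Proof.
apply: (iffP imsetP) => [[_ /imsetP[[[x y] z] _ ->] ->]|[x [y [z ->]]]].
  by exists x, y, z.
by exists (Y m x y z); rewrite ?mem_Usyl.
Qed.

Lemma varsigmaD (t x y : F) :
  varsigma m t (x + y) = varsigma m t x + varsigma m t y.
Proof. by rewrite /varsigma -!/(ree_twist m _) ree_twistD; ring. Qed.

Lemma varsigmaN (t x : F) : varsigma m t (- x) = - varsigma m t x.
Proof. by rewrite /varsigma -!/(ree_twist m _) ree_twistN; ring. Qed.

Lemma varsigma0l (x : F) : varsigma m 0 x = 0.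
Proof. by rewrite /varsigma -/(ree_twist m 0) ree_twist0 !mul0r subr0. Qed.

Lemma varsigma0r (t : F) : varsigma m t 0 = 0.
Proof. by rewrite /varsigma -/(ree_twist m 0) ree_twist0 !mulr0 subr0. Qed.

Lemma mem_add_coset (x y : F) (H : {set F}) : (y \in add_coset x H) = (y - x \in H).
Proof.
apply/imsetP/idP => [[h Hh ->]|Hyx]; first by rewrite addrC addKr.
by exists (y - x) => //; rewrite addrC subrK.
Qed.

Lemma im_varsigma0 (t : F) : 0 \in im_varsigma m t.
Proof. by apply/imsetP; exists 0; rewrite ?varsigma0r. Qed.

Lemma im_varsigmaB (t x y : F) :
  x \in im_varsigma m t -> y \in im_varsigma m t -> x - y \in im_varsigma m t.
Proof.
move=> /imsetP[u _ ->] /imsetP[v _ ->].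
by apply/imsetP; exists (u - v); rewrite // varsigmaD varsigmaN.
Qed.

Lemma eq_add_coset (t x y : F) :
  y \in add_coset x (im_varsigma m t) ->
  add_coset y (im_varsigma m t) = add_coset x (im_varsigma m t).
Proof.
rewrite mem_add_coset => yx; apply/setP => z; rewrite !mem_add_coset.
apply/idP/idP => zx.
  (* The sum of [z - y] and [y - x] is rewritten with differences only, to use [im_varsigmaB]. *)
  have -> : z - x = z - y - (0 - (y - x)) by ring.
  by do ?apply: im_varsigmaB => //; exact: im_varsigma0.
have -> : z - y = z - x - (y - x) by ring.
exact: im_varsigmaB.
Qed.

(** * Conjugacy classes of elements given by coordinates *)

Lemma class_Y00 (c : F) : (Y m 0 0 c ^: Usyl m F)%g = [set Y m 0 0 c].
Proof.
have fix_c x y z : (Y m 0 0 c ^ Y m x y z)%g = Y m 0 0 c.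
  by rewrite Y_conj varsigma0l ree_twist0; apply: eq_Y; ring.
apply/setP => g; rewrite inE; apply/mem_classY/eqP => [[x [y [z ->]]] //|->].
by exists 0, 0, 0; rewrite fix_c.
Qed.

Lemma class_Y0 (b c : F) :
  b != 0 -> (Y m 0 b c ^: Usyl m F)%g = [set Y m 0 b s | s : F].
Proof.
move=> b0; have conj_b x y z : (Y m 0 b c ^ Y m x y z)%g = Y m 0 b (c - b * x).
  by rewrite Y_conj varsigma0l ree_twist0; apply: eq_Y; ring.
apply/setP => g; apply/mem_classY/imsetP => [[x [y [z ->]]]|[s _ ->]].
  by rewrite conj_b; exists (c - b * x).
(* The witness solves [c - b * x = s] for [x]. *)
by exists ((c - s) / b), 0, 0; rewrite conj_b mulrC divfK // subKr.
Qed.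

Lemma class_Y (a b c : F) : a != 0 ->
  (Y m a b c ^: Usyl m F)%g =
  [set Y m a s3 s4 | s3 in add_coset b (im_varsigma m a), s4 in [set: F]].
Proof.
move=> a0; apply/setP => g.
apply/mem_classY/imset2P => [[x [y [z ->]]]|[s3 s4 + _ ->]].
  rewrite Y_conj; set k := (X in Y m a _ X).
  exists (b - varsigma m a x) k => //.
  by rewrite mem_add_coset addrC addKr -varsigmaN imset_f.
rewrite mem_add_coset => /imsetP[s _ es].
(* Conjugation subtracts [varsigma], hence the first coordinate [- s]. Then [k] is the last
   coordinate obtained with [y = 0], and [y = (s4 - k) / a] corrects it to [s4]. *)
pose k := c - a ^+ 2 * sigma (- s) + a * - s * sigma (- s) - b * - s
  + (- s) ^+ 2 * sigma a - a * - s * sigma a.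
exists (- s), ((s4 - k) / a), 0; rewrite Y_conj varsigmaN -es -/k.
apply: eq_Y => //; first by ring.
by rewrite mulrC divfK // addrC subrK.
Qed.

(** * The kernel of [varsigma] and the size of its image *)

Lemma varsigma_eq0 (t s : F) :
  t != 0 -> (varsigma m t s == 0) = (s \in [:: 0; t; - t]).
Proof.
move=> t0; have st0 : sigma t != 0 by rewrite expf_neq0.
(* With [s = t * u], the value factors as [t * sigma t * (sigma u - u)], so the kernel is [t] times
   the fixed points of [sigma]. *)
have -> : s = t * (s / t) by rewrite mulrC divfK.
move: (s / t) => u; rewrite /varsigma -!/(ree_twist m _) ree_twistM.
have -> : t * (sigma t * sigma u) - sigma t * (t * u) = t * sigma t * (sigma u - u).
  by ring.
rewrite mulf_eq0 mulf_eq0 (negPf t0) (negPf st0) /= subr_eq0 !inE.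
rewrite -mulrN1 mulf_eq0 (negPf t0) /=.
have -> : (t * u == t) = (u == 1) by rewrite -{2}[t]mulr1 (inj_eq (mulfI t0)).
rewrite (inj_eq (mulfI t0)).
apply/eqP/idP => [fix_u|].
  have : u * ((u - 1) * (u + 1)) = 0.
    have -> : u * ((u - 1) * (u + 1)) = u ^+ 3 - u by ring.
    by rewrite -ree_twistK !fix_u subrr.
  by move/eqP; rewrite !mulf_eq0 subr_eq0 addr_eq0.
by case/or3P => /eqP->; rewrite ?ree_twist0 ?ree_twistN /ree_twist ?expr1n.
Qed.

Lemma card_im_varsigma (t : F) : t != 0 -> #|im_varsigma m t| = (3 ^ (2 * m))%N.
Proof.
move=> t0; apply/eqP; rewrite -(eqn_pmul2r (isT : 0 < 3)%N).
rewrite -expnSr -[(2 * m).+1]addn1 -cardF.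
(* The field is counted by the fibres of [varsigma m t]; each is a coset of the kernel, [s],
   [s + t], [s - t], with three distinct elements. *)
rewrite -[X in _ == X]sum1_card (partition_big_imset (varsigma m t)) /=.
rewrite -sum_nat_const; apply/eqP; apply: eq_big => [y|_ /imsetP[s _ ->]].
  by apply/imsetP/imsetP => -[s _ ->]; exists s.
rewrite sum1_card.
have tN : t != - t.
  rewrite -addr_eq0 -mulr2n -mulr_natl mulf_eq0 (negPf t0) orbF.
  by rewrite (natr_char3 F3 2) oppr_eq0 oner_eq0.
have U : uniq [:: s; s + t; s - t].
  rewrite /= !inE negb_or (inj_eq (addrI s)) tN !andbT.
  by rewrite -!(subr_eq0 s) opprD opprB !addNKr addrC subrK oppr_eq0 t0.
rewrite -[LHS]/(size [:: s; s + t; s - t]) -(card_uniqP U); apply: eq_card => x.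
transitivity (varsigma m t (x - s) == 0); last first.
  by rewrite varsigmaD varsigmaN subr_eq0.
by rewrite varsigma_eq0 // !inE subr_eq0 !subr_eq (addrC t) (addrC (- t)).
Qed.

End Ree.

(** * Matching the classes with the rows of the list *)

Section Rows.
Variables (m : nat) (F : finFieldType).
Hypothesis cardF : #|F| = (3 ^ (2 * m + 1))%N.

Lemma mem_row_class (r : class_row F) (a b c : F) :
  (Y m a b c \in row_class m r) =
  match r with
  | RowI => [&& a == 0, b == 0 & c == 0]
  | RowY4 t4 => [&& a == 0, b == 0 & c == t4]
  | RowY3 t3 => (a == 0) && (b == t3)
  | RowY1 t1 t3 => (a == t1) && (b \in add_coset t3 (im_varsigma m t1))
  end.
Proof.
case: r => [|t4|t3|t1 t3] /=; rewrite ?inE.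
- apply/eqP/and3P => [/(Y_inj cardF)[-> -> ->] //|[/eqP-> /eqP-> /eqP->] //].
- apply/eqP/and3P => [/(Y_inj cardF)[-> -> ->] //|[/eqP-> /eqP-> /eqP->] //].
- apply/imsetP/andP => [[s _ /(Y_inj cardF)[-> -> _]] //|[/eqP-> /eqP->]].
  by exists c.
apply/imset2P/andP => [[s3 s4 Hs3 _ /(Y_inj cardF)[-> -> _]]|[/eqP-> Hb]].
  by rewrite eqxx.
by exists b c.
Qed.

Lemma card_row_class (r : class_row F) :
  (if r is RowY1 t1 _ then t1 != 0 else true) ->
  #|row_class m r| = row_size m r.
Proof.
case: r => [|t4|t3|t1 t3] /= t10; rewrite ?cards1 //.
  by rewrite card_imset // => s s' /(Y_inj cardF)[].
rewrite curry_imset2X card_imset; last first.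
  by move=> [s3 s4] [s3' s4'] /(Y_inj cardF)[_ /= -> ->].
by rewrite cardsX cardsT (card_imset _ (addrI t3)) card_im_varsigma // mulnC.
Qed.

Variable T : F -> {set F}.
Hypothesis transT : forall t, t != 0 -> add_transversal (T t) (im_varsigma m t).

Lemma card_transversal_coset (t x : F) :
  t != 0 -> #|T t :&: add_coset x (im_varsigma m t)| = 1%N.
Proof.
move=> /transT/and3P[_ _ /forall_inP T1]; apply/eqP/T1.
exact: imset_f.
Qed.

Lemma row_class_representative (r : class_row F) :
  row_admissible T r ->
  (row_representative m r ^: Usyl m F)%g = row_class m r.
Proof.
case: r => [_|t4 _|t3 t30|t1 t3 /andP[t10 _]] /=.
- by rewrite -(Y000 cardF) class_Y00.
- exact: class_Y00.
- exact: class_Y0.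
- exact: class_Y.
Qed.

(** The representative of [r] lies in the class of [r'], so [mem_row_class] compares parameters:
    rows of different kinds contradict a nonvanishing condition. *)
Lemma row_class_inj (r r' : class_row F) :
  row_admissible T r -> row_admissible T r' ->
  row_class m r = row_class m r' -> r = r'.
Proof.
move=> Tr Tr' eqC; have : row_representative m r \in row_class m r'.
  rewrite -eqC -row_class_representative //.
  by apply/imsetP; exists (Y m 0 0 0); rewrite ?mem_Usyl // (Y000 cardF) conjg1.
move: r r' Tr Tr' {eqC} => [|t4|t3|t1 t3] [|t4'|t3'|t1' t3'];
  rewrite [row_representative _ _]/= -?(Y000 cardF) mem_row_class /=;
  rewrite ?eqxx //= ?(eq_sym 0).
- by move=> _ /negPf->.
- by move=> _ /negPf->.
- by move=> _ /andP[/negPf-> _].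
- by move=> /negPf->.
- by move=> _ _ /eqP->.
- by move=> _ /negPf->.
- by move=> _ /andP[/negPf-> _].
- by move=> /negPf->.
- by move=> /negPf->.
- by move=> _ _ /eqP->.
- by move=> _ /andP[/negPf-> _].
- by move=> /andP[/negPf-> _].
- by move=> /andP[/negPf-> _].
- by move=> /andP[/negPf-> _].
(* Both [t3] and [t3'] belong to [T t1] and to the coset of [t3'], which the transversal meets only
   once. *)
move=> /andP[t10 Tt3] /andP[_ Tt3'] /andP[/eqP t1E Ht3]; move: Tt3' Ht3.
rewrite -t1E => Tt3' Ht3; congr RowY1.
have /eqP/cards1P[u Eu] := card_transversal_coset t3' t10.
have : t3 \in [set u] by rewrite -Eu inE Tt3.
have : t3' \in [set u].
  by rewrite -Eu inE Tt3' mem_add_coset subrr im_varsigma0.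
by rewrite !inE => /eqP-> /eqP->.
Qed.

(** The first nonzero coordinate of an element selects the row; when it is [a], the row's [t3] is
    the element of [T a] in the coset of [b]. *)
Lemma class_is_row (C : {set {'GL_8[F]}}) :
  C \in classes (Usyl m F) ->
  exists2 r : class_row F, row_admissible T r & C = row_class m r.
Proof.
case/imsetP=> _ /imsetP[[[a b] c] _ ->] -> /=.
have [->|a0] := eqVneq a 0; last first.
  have /eqP/cards1P[t3 Et3] := card_transversal_coset b a0.
  have := set11 t3; rewrite -Et3 inE => /andP[Tt3 bt3].
  exists (RowY1 a t3); first by rewrite /= a0.
  by rewrite class_Y // /row_class (eq_add_coset cardF bt3).
have [->|b0] := eqVneq b 0; last by exists (RowY3 b); rewrite //= class_Y0.
rewrite class_Y00 //; have [->|c0] := eqVneq c 0; first by exists RowI.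
by exists (RowY4 c).
Qed.

End Rows.

Theorem proposition6p3 (m : nat) (F : finFieldType)
    (hF : #|F| = (3 ^ (2 * m + 1))%N)
    (T : F -> {set F})
    (hT : forall t : F, t != 0%R -> add_transversal (T t) (im_varsigma m t)) :
  (forall r : class_row F, row_admissible T r ->
     [/\ row_class m r \in classes (Usyl m F),
         (row_representative m r ^: Usyl m F)%g = row_class m r
       & #|row_class m r| = row_size m r])
  /\ (forall C : {set {'GL_8[F]}}, C \in classes (Usyl m F) ->
        exists! r : class_row F, row_admissible T r /\ C = row_class m r).
Proof.
split=> [r Tr|C /(class_is_row hF hT)[r Tr ->]]; last first.
  by exists r; split=> // r' [Tr' /(row_class_inj hF hT Tr Tr')].
have repC := row_class_representative hF Tr; split=> //.
  rewrite -repC; apply: imset_f.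
  by case: {Tr repC} r => *; rewrite /= -?(Y000 hF) mem_Usyl.
by apply: card_row_class => //; case: {repC} r Tr => //= t1 t3 /andP[].
Qed.
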